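(* Let $r,q$ be positive integers, and suppose that the Scarf complex $\mathbb{S}^r_q$ supports a free resolution of $\mathcal{E}_q^{\,r}$. Then $\mathbb{S}^r_{q-1}$ supports a free resolution of $\mathcal{E}_{q-1}^{\,r}$ (when $q\ge 2$), and $\mathbb{S}^{r-1}_q$ supports a free resolution of $\mathcal{E}_q^{\,r-1}$ (when $r\ge 2$).
   Context: Let $\mathsf{k}$ be a field and $[q]=\{1,\dots,q\}$. For $q\ge1$, the $q$-extremal ideal $\mathcal{E}_q$ is the ideal of the polynomial ring $\mathcal{S}_q=\mathsf{k}[x_A : \emptyset\ne A\subseteq[q]]$ generated by the monomials $\epsilon_i=\prod_{A\subseteq [q],\, i\in A} x_A$, $i\in[q]$; $\mathcal{E}_q^{\,r}$ is its $r$-th power. It is minimally generated by the monomials $\epsilon^{\mathbf a}=\epsilon_1^{a_1}\cdots\epsilon_q^{a_q}$, where $\mathbf a$ runs over $\mathcal{N}^r_q=\{\mathbf a\in\mathbb{N}^q : a_1+\cdots+a_q=r\}$ (distinct $\mathbf a$ give distinct generators). For a monomial ideal $I$ with minimal monomial generators $m_1,\dots,m_t$, the Taylor complex $\mathbb{T}(I)$ is the full simplex on the generators, each face $\sigma$ being labeled by the monomial $\mathbf{m}_\sigma=\mathrm{lcm}(m_i : m_i\in\sigma)$. The Scarf complex of $I$ is the subcomplex of all faces $\sigma$ of $\mathbb{T}(I)$ such that $\mathbf{m}_\sigma\neq\mathbf{m}_\tau$ for all faces $\tau\ne\sigma$ of $\mathbb{T}(I)$. $\mathbb{S}^r_q$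 denotes the Scarf complex of $\mathcal{E}_q^{\,r}$. A subcomplex $\Delta$ of $\mathbb{T}(I)$ supports a free resolution of $I$ if the homogenized simplicial chain complex of $\Delta$ (with $F_i$ the free module on the $i$-faces of $\Delta$, differential $\partial(\sigma)=\sum_{v\in\sigma}\pm\frac{\mathbf{m}_\sigma}{\mathbf{m}_{\sigma\setminus\{v\}}}\,(\sigma\setminus\{v\})$ with the usual simplicial signs, and augmentation $F_0\to I$ sending each vertex to its label) is a free resolution of $I$. *)

(* Defs.v *)
From HB Require Import structures.
From mathcomp Require Import all_boot all_order all_algebra.
From mathcomp Require Import mpoly.

Set Implicit Arguments.
Unset Strict Implicit.
Unset Printing Implicit Defensive.

Import GRing.Theory.
Local Open Scope ring_scope.

Section Ideals.
Variable R : comNzRingType.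
Implicit Types (G I : R -> Prop) (p : R).

Definition ideal_gen G p : Prop :=
  exists s : seq (R * R),
    (forall x, x \in s -> G x.2) /\ p = \sum_(x <- s) x.1 * x.2.

Definition ideal_pow I (r : nat) : R -> Prop :=
  ideal_gen (fun p => exists t : r.-tuple R,
    (forall i, I (tnth t i)) /\ p = \prod_(i < r) tnth t i).

End Ideals.

(* A finite family of monomials is given by its exponent vectors              *)
(* [m : V -> 'X_{1..n}]; divisibility is [<=] on exponents, and the full      *)
(* simplex on the family (the Taylor complex) is [{set V}].                   *)
Section MonomialComplexes.
Variables (k : fieldType) (n : nat) (V : finType) (m : V -> 'X_{1..n}).
Local Notation S := {mpoly k[n]}.
Implicit Types (s t : {set V}) (D : {set {set V}}).

Definition minimal_generators (I : S -> Prop) : Prop :=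
  (forall u v, (m u <= m v)%MM -> u = v) /\
  (forall p, I p <-> ideal_gen (fun x => exists v, x = 'X_[m v]) p).

Definition label s : 'X_{1..n} := \big[@mlcm n/0%MM]_(v in s) m v.

Definition scarf : {set {set V}} :=
  [set s | [forall t : {set V}, (t != s) ==> (label t != label s)]].

Definition face D (i : nat) := {s : {set V} | (s \in D) && (#|s| == i.+1)}.

Definition chain D (i : nat) := {ffun face D i -> S}.

(* The simplicial sign of [v] in [s], for the enumeration order on [V].       *)
Definition face_sign s (v : V) : S :=
  (-1) ^+ #|[set u in s | (enum_rank u < enum_rank v)%N]|.

(* The coefficient of the face [t] in the boundary of the face [s]; the       *)
(* truncated difference of exponents is the exact quotient of labels.         *)
Definition bd_coef s t : S :=
  \sum_(v in s | s :\ v == t) face_sign s v * 'X_[(label s - label (s :\ v))%MM].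

Definition bd D i (c : chain D i.+1) : chain D i :=
  [ffun t => \sum_s c s * bd_coef (val s) (val t)].

Definition augmentation D (c : chain D 0) : S :=
  \sum_s c s * 'X_[label (val s)].

Definition supports_free_resolution D (I : S -> Prop) : Prop :=
  [/\ forall p, I p <-> exists c : chain D 0, augmentation c = p,
      forall c : chain D 0,
        augmentation c = 0 <-> exists b : chain D 1, bd b = c
    & forall i (c : chain D i.+1),
        bd c = 0 <-> exists b : chain D i.+2, bd b = c].

Lemma labelE s i : label s i = (\max_(v in s) m v i)%N.
Proof.
apply: (big_morph (fun x : 'X_{1..n} => x i)) => [x y|]; last exact: mnm0E.
by rewrite /mlcm mnmE.
Qed.

Lemma label_setU s t : label (s :|: t) = mlcm (label s) (label t).
Proof.
apply/mnmP => i; rewrite mnmE !labelE; apply/eqP; rewrite eqn_leq geq_max.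
apply/andP; split; last first.
  apply/andP; split; apply/bigmax_leqP => v vs;
    by apply: (bigmax_sup v); rewrite ?inE ?vs ?orbT.
apply/bigmax_leqP => v; rewrite inE leq_max => /orP[] vs; apply/orP.
  by left; apply: (bigmax_sup v).
by right; apply: (bigmax_sup v).
Qed.

Lemma scarf_closed s t : s \in scarf -> t \subset s -> t \in scarf.
Proof.
have scarfE u : u \in scarf -> forall w, label w = label u -> w = u.
  rewrite inE => /forallP h w e; apply/eqP; apply: contraT => ne.
  by have := implyP (h w) ne; rewrite e eqxx.
move=> /scarfE hs ts; rewrite inE; apply/forallP => w; apply/implyP.
apply: contra => /eqP lw; have es : s = (s :\: t) :|: t.
  by apply/setP => v; rewrite !inE; case: (boolP (v \in t)) => //=;
     rewrite ?orbT ?orbF // => /(subsetP ts).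
have ws : (s :\: t) :|: w = s.
  by apply: hs; rewrite [in RHS]es !label_setU lw.
have tw : t \subset w.
  apply/subsetP => v vt; have := subsetP ts _ vt.
  by rewrite -[in X in X -> _]ws !inE vt.
rewrite eqEsubset tw andbT; apply/subsetP => v vw; apply: contraT => vt.
have vs : v \in s by rewrite -ws inE vw orbT.
have sve : s :\ v = s.
  apply: hs; have tv : t \subset s :\ v by rewrite subsetD1 ts.
  have {1}<- : (s :\ v) :|: t = s :\ v by apply/setUidPl.
  rewrite label_setU -lw -label_setU; congr (label _).
  apply/setP => x; rewrite !inE; have [->|] /= := eqVneq x v.
    by rewrite vw vs.
  by move=> _; case: (boolP (x \in s)) => //= xs; apply: contraNF xs => xw;
     rewrite -ws inE xw orbT.
by move: vs; rewrite -sve !inE eqxx.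
Qed.

End MonomialComplexes.

Definition nonempty_subset (q : nat) := {A : {set 'I_q} | A != set0}.

Definition nvars (q : nat) : nat := #|{: nonempty_subset q}|.

Definition extremal_gen (q : nat) (i : 'I_q) : 'X_{1..nvars q} :=
  (\sum_(A : nonempty_subset q | i \in val A) U_(enum_rank A))%MM.

Definition extremal_ideal (k : fieldType) (q : nat) : {mpoly k[nvars q]} -> Prop :=
  ideal_gen (fun p => exists i : 'I_q, p = 'X_[extremal_gen i]).

(* The entries of a vector of natural numbers with sum [r] are at most [r],   *)
(* so the codomain ['I_r.+1] is no restriction.                               *)
Definition weight (q r : nat) :=
  {a : {ffun 'I_q -> 'I_r.+1} | (\sum_i a i)%N == r}.

Definition extremal_pow_gen (q r : nat) (a : weight q r) : 'X_{1..nvars q} :=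
  (\sum_(i < q) extremal_gen i *+ val a i)%MM.

Definition extremal_scarf (q r : nat) : {set {set weight q r}} :=
  scarf (@extremal_pow_gen q r).

Definition scarf_resolves (k : fieldType) (q r : nat) : Prop :=
  supports_free_resolution (@extremal_pow_gen q r) (extremal_scarf q r)
    (ideal_pow (@extremal_ideal k q) r).

Section IdealFacts.
Variable R : comNzRingType.
Implicit Types (G : R -> Prop) (p : R).

Lemma ideal_gen0 G : ideal_gen G 0.
Proof. by exists [::]; rewrite big_nil. Qed.

Lemma ideal_genD G x y : ideal_gen G x -> ideal_gen G y -> ideal_gen G (x + y).
Proof.
move=> [s [hs ->]] [t [ht ->]]; exists (s ++ t); rewrite big_cat; split=> // z.
by rewrite mem_cat => /orP[/hs|/ht].
Qed.

Lemma ideal_genM G c x : ideal_gen G x -> ideal_gen G (c * x).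
Proof.
move=> [s [hs ->]]; exists [seq (c * z.1, z.2) | z <- s]; split.
  by move=> _ /mapP[z /hs Gz ->].
by rewrite big_map mulr_sumr; apply: eq_bigr => z _; rewrite mulrA.
Qed.

Lemma ideal_gen_mem G x : G x -> ideal_gen G x.
Proof.
move=> Gx; exists [:: (1, x)]; split; last by rewrite big_seq1 mul1r.
by move=> z; rewrite inE => /eqP ->.
Qed.

Lemma ideal_gen_min G (K : R -> Prop) :
    K 0 -> (forall x y, K x -> K y -> K (x + y)) ->
    (forall c x, G x -> K (c * x)) ->
  forall p, ideal_gen G p -> K p.
Proof.
move=> K0 KD KG p [s [hs ->]]; rewrite big_seq.
by apply: (big_ind K) => // z zs; apply/KG/hs.
Qed.

End IdealFacts.

Lemma extremal_genE q (i : 'I_q) (A : nonempty_subset q) :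
  extremal_gen i (enum_rank A) = (i \in val A).
Proof.
rewrite /extremal_gen mnm_sumE (bigID (pred1 A)) /=.
rewrite [X in (_ + X)%N]big1 ?addn0; last first.
  move=> B /andP[_ ne]; rewrite mnm1E; apply/eqP; rewrite eqb0.
  by rewrite (inj_eq enum_rank_inj).
case: (boolP (i \in val A)) => iA; last first.
  rewrite big1 // => B /andP[iB /eqP e]; move: iA; rewrite -e iB //.
rewrite (bigD1 A) ?iA ?eqxx //= mnm1E eqxx big1 // => B.
by case/andP => /andP[_ ->].
Qed.

Lemma extremal_pow_genE q r (a : weight q r) (A : nonempty_subset q) :
  extremal_pow_gen a (enum_rank A) = (\sum_(i in val A) val a i)%N.
Proof.
rewrite /extremal_pow_gen mnm_sumE [RHS]big_mkcond; apply: eq_bigr => i _.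
by rewrite mulmnE extremal_genE; case: (i \in _); rewrite ?mul1n ?mul0n.
Qed.

Lemma extremal_pow_gen_min (k : fieldType) (q r : nat) :
  minimal_generators (@extremal_pow_gen q r)
    (ideal_pow (@extremal_ideal k q) r).
Proof.
split=> [a b /mnm_lepP ab|p].
  have le i : (val a i <= val b i)%N.
    have i1 : [set i] != set0 :> {set 'I_q} by rewrite -card_gt0 cards1.
    have := ab (enum_rank (exist _ [set i] i1 : nonempty_subset q)).
    by rewrite !extremal_pow_genE /= !big_set1.
  apply: val_inj; apply/ffunP => i; apply/val_inj/eqP.
  have [_] := leqif_sum (fun j (_ : true) => leqif_eq (le j)).
  by rewrite (eqP (valP a)) (eqP (valP b)) eqxx => /esym/forallP/(_ i).
pose M (l : seq 'I_q) : {mpoly k[nvars q]} := \prod_(j <- l) 'X_[extremal_gen j].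
pose J s := ideal_gen (fun x => exists2 l, size l = s & x = M l).
have toM (a : weight q r) : exists2 l, size l = r & 'X_[extremal_pow_gen a] = M l.
  exists (flatten [seq nseq (val a i) i | i <- index_enum 'I_q]).
    rewrite size_flatten /shape -map_comp sumnE big_map -[RHS](eqP (valP a)).
    by apply: eq_bigr => i _; rewrite /= size_nseq.
  rewrite /M big_flatten big_map /extremal_pow_gen.
  rewrite (big_morph (fun m => 'X_[m] : {mpoly k[nvars q]})
    (id1 := 1) (op1 := *%R) _ _); [|exact: mpolyXD|exact: mpolyX0].
  by apply: eq_bigr => i _; rewrite big_nseq iter_mulr_1 mpolyXn.
have ofM l : size l = r -> exists a : weight q r, M l = 'X_[extremal_pow_gen a].
  move=> sl; have ub i : (count_mem i l < r.+1)%N by rewrite ltnS -sl count_size.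
  pose a : {ffun 'I_q -> 'I_r.+1} := [ffun i => Ordinal (ub i)].
  have wP : (\sum_i a i)%N == r.
    rewrite -[X in _ == X]sl -sum1_size; apply/eqP.
    under eq_bigr do rewrite ffunE /= -sum1_count.
    rewrite (exchange_big_dep predT) //=; apply: eq_bigr => j _.
    by rewrite (big_pred1 j) // => i; rewrite eq_sym.
  exists (exist _ a wP : weight q r); rewrite /extremal_pow_gen /M.
  rewrite -(big_morph (fun m => 'X_[m] : {mpoly k[nvars q]})
    (@mpolyXD _ _) (@mpolyX0 _ _)); congr 'X_[_].
  apply/mnmP => A; rewrite !mnm_sumE.
  under [RHS]eq_bigr do rewrite mulmnE /= ffunE /= -sum1_count big_distrr /=.
  rewrite (exchange_big_dep predT) //=; apply: eq_bigr => j _.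
  by rewrite (big_pred1 j) ?muln1 // => i; rewrite eq_sym.
split; apply: ideal_gen_min => [||c x]; try exact: ideal_gen0;
  try exact: ideal_genD.
- case=> t [ht ->]; apply: ideal_genM.
  suff: J r (\prod_(i < r) tnth t i).
    apply: ideal_gen_min => [||d y]; [exact: ideal_gen0|exact: ideal_genD|].
    case=> l /ofM[a Ma] ->; apply: ideal_genM; apply: ideal_gen_mem.
    by exists a.
  have {ht} ht y : y \in val t -> extremal_ideal y by case/tnthP=> i ->; exact: ht.
  rewrite -(big_tuple _ _ _ xpredT id).
  case: t ht => t /= /eqP <-; elim: t => [|y t IH] ht.
    by rewrite big_nil; apply: ideal_gen_mem; exists [::]; rewrite // /M big_nil.
  have ht' z : z \in t -> extremal_ideal z by move=> zt; apply: ht; rewrite inE zt orbT.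
  rewrite big_cons; have {IH} := IH ht'.
  apply: (@ideal_gen_min _ _ (fun z => J _ (y * z))) => [|u v Ju Jv|d _ [l sl ->]].
  + by rewrite mulr0; exact: ideal_gen0.
  + by rewrite mulrDr; exact: ideal_genD.
  rewrite mulrCA; apply: ideal_genM; have := ht y (mem_head _ _).
  apply: (@ideal_gen_min _ _ (fun z => J _ (z * M l))) => [|u v Ju Jv|e _ [i ->]].
  + by rewrite mul0r; exact: ideal_gen0.
  + by rewrite mulrDl; exact: ideal_genD.
  rewrite -mulrA; apply/ideal_genM/ideal_gen_mem; exists (i :: l).
    by rewrite /= sl.
  by rewrite /M big_cons.
case=> a ->; apply: ideal_genM; apply: ideal_gen_mem; case: (toM a) => l sl ->.
have sz : size [seq 'X_[extremal_gen j] : {mpoly k[nvars q]} | j <- l] == r.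
  by rewrite size_map sl.
exists (Tuple sz); split=> [i|]; last first.
  by rewrite -(big_tuple _ _ _ xpredT id) /= big_map.
have /mapP[j _ ->] := mem_tnth i (Tuple sz).
by apply: ideal_gen_mem; exists j.
Qed.

(* Main.v *)
Require Import Defs.
From mathcomp Require Import all_boot all_order all_algebra.
From mathcomp Require Import mpoly.

(** The proof restricts a resolution to the generators that divide a monomial.
A simplicial complex of generators carries a multigraded chain complex, so its
exactness can be tested one multidegree [u] at a time.  In degree [u] the chains
are the chains with coefficients in [k] of the subcomplex of the faces whose
label divides [x^u].  Hence, once the vertices generate the ideal, a complex
supports a resolution exactly when all these subcomplexes are acyclic over [k]
([acyclic_of_resolution], [resolution_of_acyclic]); this is the criterion of
Bayer, Peeva and Sturmfels.  It no longer mentions the polynomial ring, so it can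
compare ideals that live in different rings.

Both halves of the theorem embed the vectors [a] indexing the generators of the
smaller power into those of the larger one: [extend] adds an entry equal to 0,
[shift] adds 1 to one entry.  In either case the image consists of the generators
that divide a suitable monomial.  For [extend] the exponent of the variable of
[{0}] is forced to be 0.  For [shift] the exponent of the variable of the
complement of [{0}] is bounded by [r] among vectors of sum [r + 1], which says
that the entry at 0 is positive.  The embedding also respects equality of least
common multiples, because each exponent of an embedded generator is 0 or is an
exponent of the original one plus a constant that depends only on the variable
([extend_label], [shift_label]).  Therefore every subcomplex of bounded label of
the smaller Scarf complex is isomorphic to one of the larger Scarf complex
([scarf_imset], [scarf_acyclic_transfer]), and acyclicity passes to it.

The isomorphism need not respect the enumerations that fix the simplicial signs;
multiplying each face by the sign of the reordering of its vertices repairs this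
([twist_orient]). *)

Set Implicit Arguments.
Unset Strict Implicit.
Unset Printing Implicit Defensive.

Import GRing.Theory.
Local Open Scope ring_scope.

(** * Chains with scalar coefficients *)

Section ScalarChains.
Variables (k : fieldType) (V : finType).
Implicit Types (K : {set {set V}}) (rk : V -> nat) (s t : {set V}).
Implicit Types (g : {ffun {set V} -> k}).

Definition orient rk t v : k := \prod_(u in t) (-1) ^+ (rk u < rk v)%N.

(** A chain is a function on all sets of vertices, so that the vertices, whose
boundary is the augmentation, and the faces of every dimension are treated at
once; [carried] then restricts the support.  The vertex order is a parameter
[rk], since complexes with different enumerations have to be compared. *)
Definition bdry rk g : {ffun {set V} -> k} :=
  [ffun t : {set V} => \sum_(v | v \notin t) orient rk t v * g (v |: t)].

Definition carried K j g := forall s, g s != 0 -> s \in K /\ #|s| = j.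

(** The index starts at the chains on vertices, which a supported resolution
relates to the ideal by the augmentation: this is vanishing of the reduced
homology of [K] in degrees at least 0.  The equivalence also asserts that
boundaries are cycles, as the definition of a supported resolution does, so that
both halves pass together from one complex to the other. *)
Definition acyclic rk K := forall i g, carried K i.+1 g ->
  bdry rk g = 0 <-> exists2 b, carried K i.+2 b & bdry rk b = g.

Lemma bdryD rk g h : bdry rk (g + h) = bdry rk g + bdry rk h.
Proof.
apply/ffunP => t; rewrite !ffunE -big_split; apply: eq_bigr => v _.
by rewrite ffunE mulrDr.
Qed.

Lemma bdry0 rk : bdry rk 0 = 0.
Proof.
by apply/ffunP => t; rewrite !ffunE big1 // => v _; rewrite ffunE mulr0.
Qed.

(** The sign of the permutation that sorts [s] for [rk'] when [s] is listed in
the order of [rk]: one factor -1 for each inversion. *)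
Definition twist rk rk' s : k :=
  \prod_(u in s) \prod_(w in s) (-1) ^+ ((rk u < rk w) && (rk' w < rk' u))%N.

Lemma orient_sq rk t v : orient rk t v * orient rk t v = 1.
Proof.
by rewrite /orient -big_split big1 // => u _; exact: sqrr_sign.
Qed.

Lemma twist_sq rk rk' s : twist rk rk' s * twist rk rk' s = 1.
Proof.
rewrite /twist -big_split big1 // => u _; rewrite -big_split big1 // => w _.
exact: sqrr_sign.
Qed.

(** A vertex [u] of [s] and [v] are inverted exactly when one of the two orders
puts [u] before [v] and the other does not, so the new inversions of [v |: s]
count the two positions of [v] together modulo 2. *)
Lemma twist_orient rk rk' s v : injective rk -> injective rk' -> v \notin s ->
  orient rk s v * twist rk rk' (v |: s) = twist rk rk' s * orient rk' s v.
Proof.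
move=> irk irk' vs.
suff -> : twist rk rk' (v |: s) =
    twist rk rk' s * (orient rk s v * orient rk' s v).
  by rewrite mulrCA [X in _ * X]mulrA orient_sq mul1r.
rewrite /twist big_setU1 //= big_setU1 //= ltnn mul1r.
under [X in _ * X = _]eq_bigr => u us do rewrite big_setU1 //=.
rewrite big_split /= [LHS]mulrA [LHS]mulrC; congr (_ * _).
rewrite /orient -!big_split; apply: eq_bigr => u us /=.
have uv : u != v by apply: contraNneq vs => <-.
have := uv; rewrite -(inj_eq irk); have := uv; rewrite -(inj_eq irk').
by case: (ltngtP (rk u)); case: (ltngtP (rk' u));
  rewrite //= ?mulrNN ?mulr1 ?mul1r.
Qed.

End ScalarChains.

(** * Acyclicity along an injection of vertices *)

Section Transfer.
Variables (k : fieldType) (V W : finType) (f : W -> V).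
Hypothesis f_inj : injective f.
Variables (K : {set {set V}}) (L : {set {set W}}).
Hypothesis K_codom : forall s, s \in K -> s \subset f @: [set: W].
Hypothesis LK : forall s : {set W}, (s \in L) = (f @: s \in K).
Variables (rk : V -> nat) (rk' : W -> nat).
Hypotheses (rk_inj : injective rk) (rk'_inj : injective rk').

Let eta := @twist k W rk' (rk \o f).

Definition pull (g : {ffun {set V} -> k}) : {ffun {set W} -> k} :=
  [ffun s => eta s * g (f @: s)].

Definition push (g : {ffun {set W} -> k}) : {ffun {set V} -> k} :=
  [ffun s : {set V} =>
     if s \subset f @: [set: W] then eta (f @^-1: s) * g (f @^-1: s) else 0].

Lemma preimset_imset (s : {set W}) : f @^-1: (f @: s) = s.
Proof. by apply/setP => x; rewrite inE mem_imset. Qed.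

Lemma imset_preimset (s : {set V}) :
  s \subset f @: [set: W] -> f @: (f @^-1: s) = s.
Proof.
move/subsetP => sf; apply/setP => v; apply/imsetP/idP => [[w]|vs].
  by rewrite inE => ws ->.
by have /imsetP[w _ e] := sf v vs; exists w; rewrite // inE -e.
Qed.

Lemma pushK g : pull (push g) = g.
Proof.
apply/ffunP => s; rewrite !ffunE imsetS ?subsetT // preimset_imset mulrA.
by rewrite twist_sq mul1r.
Qed.

Lemma carried_push j g : carried L j g -> carried K j (push g).
Proof.
move=> cg s; rewrite ffunE; case: ifP => [sf|]; last by rewrite eqxx.
rewrite mulf_eq0 negb_or => /andP[_ /cg[]]; rewrite LK.
by rewrite -(card_imset _ f_inj) imset_preimset.
Qed.

Lemma carried_pull j g : carried K j g -> carried L j (pull g).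
Proof.
move=> cg s; rewrite ffunE mulf_eq0 negb_or => /andP[_ /cg[]].
by rewrite LK (card_imset _ f_inj).
Qed.

Lemma bdry_codom j (g : {ffun {set V} -> k}) s :
  carried K j g -> bdry rk g s != 0 ->
  s \subset f @: [set: W].
Proof.
move=> cg; rewrite ffunE; apply: contraNT => sf; apply/eqP/big1 => v _.
have [->|/cg[/K_codom vsf _]] := eqVneq (g (v |: s)) 0; first by rewrite mulr0.
by case/negP: sf; apply: subset_trans vsf; rewrite subsetUr.
Qed.

(** The order of [V] pulled back to [W] along [f] need not be the order of [W];
the factor [eta] absorbs the difference of the signs. *)
Lemma bdry_pull j (g : {ffun {set V} -> k}) :
  carried K j g -> bdry rk' (pull g) = pull (bdry rk g).
Proof.
move=> cg; apply/ffunP => t; rewrite !ffunE.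
have rkf_inj : injective (rk \o f) by exact: inj_comp.
(* A vertex outside the image contributes nothing: no face of [K] contains it. *)
rewrite [in RHS](bigID (mem (f @: [set: W]))) /= [X in _ * (_ + X)]big1 ?addr0.
  rewrite (reindex_omap f (fun v => [pick w | f w == v])) /=; last first.
    move=> v /andP[_ /imsetP[w _ ->]].
    by case: pickP => [x /eqP /= -> //|/(_ w)]; rewrite eqxx.
  rewrite mulr_sumr; apply: eq_big => [w|w wt].
    rewrite mem_imset // imset_f // andbT.
    case: pickP => [x /eqP/f_inj ->|/(_ w)]; last by rewrite eqxx.
    by rewrite eqxx andbT.
  rewrite ffunE imsetU1 !mulrA; congr (_ * _).
  have -> : orient k rk (f @: t) (f w) = orient k (rk \o f) t w.
    by rewrite /orient big_imset //= => x y _ _; exact: f_inj.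
  exact: twist_orient.
move=> v /andP[_ vf].
have [->|/cg[/K_codom vsf _]] := eqVneq (g (v |: f @: t)) 0.
  by rewrite mulr0.
by case/negP: vf; apply: (subsetP vsf); rewrite setU11.
Qed.

Lemma pullK (g : {ffun {set V} -> k}) :
  (forall s, g s != 0 -> s \subset f @: [set: W]) ->
  push (pull g) = g.
Proof.
move=> gf; apply/ffunP => s; rewrite !ffunE; case: ifP => sf.
  by rewrite imset_preimset // mulrA twist_sq mul1r.
by apply/esym/eqP; apply: contraFT sf => /gf.
Qed.

Lemma bdry_push j (g : {ffun {set W} -> k}) :
  carried L j g -> bdry rk (push g) = push (bdry rk' g).
Proof.
move=> /carried_push cg; rewrite -[in RHS](pushK g) (bdry_pull cg) pullK //.
by move=> s; exact: bdry_codom cg.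
Qed.

Lemma acyclic_transfer : acyclic k rk K -> acyclic k rk' L.
Proof.
move=> aK i g cg; have cG := carried_push cg; split=> [g0|[b cb eb]].
  have /(aK _ _ cG)[b cb eb] : bdry rk (push g) = 0.
    rewrite (bdry_push cg) g0; apply/ffunP => s.
    by rewrite !ffunE mulr0 if_same.
  by exists (pull b); [exact: carried_pull|rewrite (bdry_pull cb) eb pushK].
have /(aK _ _ cG) G0 : exists2 c, carried K i.+2 c & bdry rk c = push g.
  by exists (push b); [exact: carried_push|rewrite (bdry_push cb) eb].
rewrite -[g]pushK (bdry_pull cG) G0; apply/ffunP => s.
by rewrite !ffunE mulr0.
Qed.

End Transfer.

(** * Multigraded strands of the chain complex *)

Lemma mcoeffMXE (k : nzRingType) n (p : {mpoly k[n]}) (m u : 'X_{1..n}) :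
  (p * 'X_[m])@_u = if (m <= u)%MM then p@_(u - m) else 0.
Proof.
case: ifP => [mu|mu]; first by rewrite -{1}(submK mu) addmC mcoeffMX.
apply/eqP; rewrite mcoeff_eq0; apply: contraFN mu => /msuppM_le.
case/allpairsP => -[a b] /= [_]; rewrite msuppX inE => /eqP -> ->.
exact: lem_addl.
Qed.

Section Strands.
Variables (k : fieldType) (n : nat) (V : finType) (m : V -> 'X_{1..n}).
Local Notation S := {mpoly k[n]}.
Implicit Types (s t : {set V}) (D : {set {set V}}) (u w : 'X_{1..n}).
Implicit Types (g h : {ffun {set V} -> k}).

Let rk : V -> nat := fun v => enum_rank v.

Definition below D u : {set {set V}} := [set s in D | (label m s <= u)%MM].

Lemma in_below D u s : (s \in below D u) = (s \in D) && (label m s <= u)%MM.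
Proof. by rewrite inE. Qed.

(** The component of multidegree [u] of a chain: the face [s] has degree
[label m s], so only the coefficient of its entry at the exponent
[u - label m s] has degree [u], when that difference exists. *)
Definition strand D i u (c : chain k n D i) : {ffun {set V} -> k} :=
  [ffun s => if insub s is Some x then
     if (label m s <= u)%MM then (c x)@_(u - label m s) else 0 else 0].

(** Truncated subtraction is harmless here: this is applied to chains carried by
[below D u]. *)
Definition homogenize {D i} u g : chain k n D i :=
  [ffun x => g (val x) *: 'X_[(u - label m (val x))%MM]].

Lemma strand_face D i u (c : chain k n D i) (x : face D i) :
  strand u c (val x) =
    if (label m (val x) <= u)%MM then (c x)@_(u - label m (val x)) else 0.
Proof. by rewrite ffunE valK. Qed.

Lemma carried_strand D i u (c : chain k n D i) :
  carried (below D u) i.+1 (strand u c).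
Proof.
move=> s; rewrite ffunE; case: insubP => [x xD <-|_]; last by rewrite eqxx.
by case: ifP => [xu _|]; rewrite ?eqxx // inE xu; case/andP: (valP x) => -> /eqP.
Qed.

Lemma strand_inj D i (c d : chain k n D i) :
  (forall u, strand u c = strand u d) -> c = d.
Proof.
move=> e; apply/ffunP => x; apply/mpolyP => w.
have /ffunP/(_ (val x)) := e (w + label m (val x))%MM.
by rewrite !strand_face lem_addl addmK.
Qed.

Lemma strandD D i u (c d : chain k n D i) :
  strand u (c + d) = strand u c + strand u d.
Proof.
apply/ffunP => s; rewrite !ffunE; case: insubP => [x _ _|_]; last by rewrite addr0.
by case: ifP; rewrite ?addr0 // ffunE mcoeffD.
Qed.

Lemma strand0 D i u : strand u (0 : chain k n D i) = 0.
Proof.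
apply/ffunP => s; rewrite !ffunE; case: insubP => // x _ _.
by case: ifP => // _; rewrite ffunE mcoeff0.
Qed.

Lemma strand_homogenize D i u w g : carried (below D u) i.+1 g ->
  strand w (homogenize u g : chain k n D i) = if w == u then g else 0.
Proof.
move=> cg; apply/ffunP => s.
have [gs|/cg[]] := eqVneq (g s) 0.
  have -> : (if w == u then g else 0) s = 0 by case: ifP; rewrite ?ffunE.
  rewrite ffunE; case: insubP => // x _ xs; rewrite ffunE xs gs scale0r mcoeff0.
  by rewrite if_same.
rewrite inE => /andP[sD su] cs.
have sP : (s \in D) && (#|s| == i.+1) by rewrite sD cs eqxx.
rewrite ffunE insubT ffunE /= mcoeffZ mcoeffX.
have [->|wu] := eqVneq w u; first by rewrite su eqxx mulr1.
rewrite [RHS]ffunE; case: ifP => // sw; case: eqP => [e|_]; last by rewrite mulr0.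
by case/eqP: wu; rewrite -(submK su) -(submK sw) e.
Qed.

(** Reindexes the boundary by the face [s = v |: t], which is how [bd] sums. *)
Lemma bdry_faces g t :
  bdry rk g t =
  \sum_(s : {set V}) \sum_(v in s | s :\ v == t) orient k rk t v * g s.
Proof.
rewrite ffunE (exchange_big_dep predT) //= big_mkcond; apply: eq_bigr => v _.
case: ifPn => vt.
  rewrite (big_pred1 (v |: t)) // => s /=; apply/andP/eqP => [[vs /eqP <-]|->].
    by rewrite setD1K.
  by rewrite setU11 setU1K.
rewrite big1 // => s /andP[_ /eqP e].
by case/negP: vt; rewrite -e setD11.
Qed.

Lemma sum_faces D i u (c : chain k n D i) (F : {set V} -> k -> k) :
    (forall s, F s 0 = 0) ->
  \sum_(s : {set V}) F s (strand u c s) =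
  \sum_(x : face D i) F (val x) (strand u c (val x)).
Proof.
move=> F0.
rewrite -(big_sub [pred s in D | #|s| == i.+1] (fun s => F s (strand u c s))).
rewrite [RHS]big_mkcond; apply: eq_bigr => s _; case: ifPn => // sN.
by rewrite ffunE; case: insubP => // x xP; case/negP: sN.
Qed.

Lemma label_le s u :
  (label m s <= u)%MM = [forall v in s, (m v <= u)%MM].
Proof.
rewrite /label (big_morph (fun x => (x <= u)%MM) (id1 := true) (op1 := andb)).
- by rewrite big_andE.
- by move=> x y; exact: lem_mlcm.
- by apply/mnm_lepP => i; rewrite mnm0E.
Qed.

Lemma label_subset s t : t \subset s -> (label m t <= label m s)%MM.
Proof.
move=> /subsetP ts; rewrite label_le; apply/forall_inP => v /ts.
by have := lepm_refl (label m s); rewrite {1}label_le => /forall_inP; apply.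
Qed.

Lemma orientE t v :
  orient k rk t v = (-1) ^+ #|[set w in v |: t | (rk w < rk v)%N]|.
Proof.
rewrite -prodr_const /orient big_mkcond [RHS]big_mkcond; apply: eq_bigr => w _.
rewrite !inE; have [->|_] /= := eqVneq w v; first by rewrite ltnn; case: ifP.
by case: (w \in t) => //; case: ltnP.
Qed.

(** The coefficients of [bd] are homogeneous for the multigrading, so passing to
degree [u] only removes the monomials. *)
Lemma mcoeff_bd_coef (p : S) s t u : (label m t <= u)%MM ->
  (p * bd_coef k m s t)@_(u - label m t) =
  \sum_(v in s | s :\ v == t) orient k rk t v *
     (if (label m s <= u)%MM then p@_(u - label m s) else 0).
Proof.
move=> tu; rewrite /bd_coef mulr_sumr raddf_sum /=.
apply: eq_bigr => v /andP[vs /eqP es].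
have es' : s = v |: t by rewrite -es setD1K.
have ts : (label m t <= label m s)%MM by rewrite label_subset // -es subsetDl.
rewrite es mulrCA /face_sign -signr_odd raddfMsign signr_odd orientE -es'.
congr (_ * _). rewrite /= mcoeffMXE.
have -> : (label m s - label m t <= u - label m t)%MM = (label m s <= u)%MM.
  apply/mnm_lepP/mnm_lepP => le i; have := le i; rewrite !mnmBE.
    by rewrite leq_sub2rE //; exact/mnm_lepP.
  exact: leq_sub2r.
case: ifP => // _; congr (p@_ _); apply/mnmP => i; rewrite !mnmBE.
by rewrite subnBA ?subnK //; exact/mnm_lepP.
Qed.

Variable D : {set {set V}}.
Hypothesis D_closed : forall s t, s \in D -> t \subset s -> t \in D.

Lemma carried_bdry j u g : carried (below D u) j.+1 g ->
  carried (below D u) j (bdry rk g).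
Proof.
move=> cg t; rewrite ffunE => nz.
have /existsP[v /andP[vt]] : [exists v, (v \notin t) && (g (v |: t) != 0)].
  apply: contraNT nz; rewrite negb_exists => /forallP h; apply/eqP/big1 => v vt.
  by have := h v; rewrite vt negbK => /eqP ->; rewrite mulr0.
move=> /cg[]; rewrite !inE cardsU1 vt add1n => /andP[vD vu] [->]; split=> //.
rewrite (D_closed vD) ?subsetUr //=.
by apply: lepm_trans vu; rewrite label_subset ?subsetUr.
Qed.

Lemma strand_bd i u (c : chain k n D i.+1) :
  strand u (bd m c) = bdry rk (strand u c).
Proof.
(* Off the faces of [below D u] of the right size both sides vanish; for the right
   hand side this uses that [D] is closed under taking subsets. *)
apply/ffunP => t; have [tK|] := boolP ((t \in below D u) && (#|t| == i.+1)).
  have [tD tu] : t \in D /\ (label m t <= u)%MM.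
    by move: tK; rewrite inE => /andP[/andP[]].
  have tP : (t \in D) && (#|t| == i.+1) by rewrite tD; case/andP: tK.
  rewrite ffunE insubT tu ffunE raddf_sum bdry_faces.
  rewrite (@sum_faces _ _ u c (fun s x =>
     \sum_(v in s | s :\ v == t) orient k rk t v * x)).
    by apply: eq_bigr => x _; rewrite /= mcoeff_bd_coef // strand_face.
  by move=> s; apply: big1 => v _; rewrite mulr0.
move=> tN; apply: etrans (_ : 0 = _).
  by apply/eqP; apply: contraNT tN => /carried_strand[-> ->]; rewrite eqxx.
have cc : carried (below D u) i.+2 (strand u c) by exact: carried_strand.
apply/esym/eqP; apply: contraNT tN => /(carried_bdry cc)[-> ->].
by rewrite eqxx.
Qed.

(** The augmentation is the boundary onto the empty face, whose label is 1. *)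
Lemma strand_aug u (c : chain k n D 0) :
  (augmentation m c)@_u = bdry rk (strand u c) set0.
Proof.
rewrite raddf_sum bdry_faces (@sum_faces _ _ u c (fun s x =>
     \sum_(v in s | s :\ v == set0) orient k rk set0 v * x)).
  apply: eq_bigr => x _; have /andP[_ /cards1P[v xv]] := valP x.
  rewrite (big_pred1 v) => [|w] /=; last first.
    rewrite xv inE; case: eqVneq => //= ->; apply/eqP/setP => y.
    by rewrite !inE; case: eqP.
  by rewrite /orient big_set0 mul1r mcoeffMXE strand_face.
by move=> s; apply: big1 => v _; rewrite mulr0.
Qed.

Lemma augmentation_eq0 (c : chain k n D 0) :
  augmentation m c = 0 <-> forall u, bdry rk (strand u c) = 0.
Proof.
split=> [c0 u|c0]; last first.
  by apply/mpolyP => u; rewrite strand_aug c0 ffunE mcoeff0.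
apply/ffunP => t; rewrite [RHS]ffunE; apply/eqP/negPn/negP => nz.
have cc : carried (below D u) 1 (strand u c) by exact: carried_strand.
have [_ /cards0_eq t0] := carried_bdry cc nz.
by move: nz; rewrite t0 -strand_aug c0 mcoeff0 eqxx.
Qed.

Lemma bd_eqP i (b : chain k n D i.+1) (c : chain k n D i) :
  bd m b = c <-> forall u, bdry rk (strand u b) = strand u c.
Proof.
split=> [<- u|e]; first by rewrite strand_bd.
by apply: strand_inj => u; rewrite strand_bd.
Qed.

Lemma bd_eq0 i (c : chain k n D i.+1) :
  bd m c = 0 <-> forall u, bdry rk (strand u c) = 0.
Proof.
split=> [/bd_eqP e u|e]; first by rewrite e strand0.
by apply/bd_eqP => u; rewrite e strand0.
Qed.

(** Only finitely many strands of [c] are nonzero, so finitely many of the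
solutions in single degrees add up to a polynomial chain. *)
Lemma strands_assemble i
    (c : chain k n D i) :
    (forall u, exists2 b, carried (below D u) i.+2 b & bdry rk b = strand u c) ->
  exists b : chain k n D i.+1, bd m b = c.
Proof.
move=> ex.
have part (U : seq 'X_{1..n}) : uniq U -> exists b : chain k n D i.+1,
    forall w, bdry rk (strand w b) = if w \in U then strand w c else 0.
  elim: U => [|u U IH] /= => [_|/andP[uU /IH[b eb]]].
    by exists 0 => w; rewrite strand0 bdry0.
  have [g cg eg] := ex u; exists (b + homogenize u g) => w.
  rewrite strandD bdryD eb strand_homogenize // inE.
  case: (eqVneq w u) => [->|_] /=; first by rewrite (negPf uU) eg add0r.
  by rewrite bdry0 addr0.
(* The degrees in which [c] has a nonzero component. *)
pose U := undup (flatten [seq [seq (w + label m (val x))%MM | w <- msupp (c x)]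
  | x <- enum {: face D i}]).
have [b eb] := part U (undup_uniq _); exists b; apply/bd_eqP => u.
rewrite eb; case: ifPn => // uU; apply/ffunP => s; rewrite [LHS]ffunE.
apply/esym/eqP; apply: contraNT uU; rewrite ffunE.
case: insubP => [x _ xs|_]; last by rewrite eqxx.
case: ifP => [xu|]; last by rewrite eqxx.
rewrite -mcoeff_msupp mem_undup => cx; apply/flattenP.
exists [seq (w + label m (val x))%MM | w <- msupp (c x)].
  by apply/mapP; exists x; rewrite ?mem_enum.
by apply/mapP; exists (u - label m s)%MM; rewrite // xs submK.
Qed.

(** The cycle condition is written on strands because this form covers both the
augmentation, for [i = 0], and the differential [bd], for [i > 0]. *)
Definition graded_exact := forall i (c : chain k n D i),
  (forall u, bdry rk (strand u c) = 0) <->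
  exists b : chain k n D i.+1, bd m b = c.

Lemma graded_exactP : graded_exact <-> forall u, acyclic k rk (below D u).
Proof.
split=> [ex u i g cg|ac i c].
  have := ex i (homogenize u g); have sg w := strand_homogenize w cg.
  move=> [ex1 ex2]; split=> [g0|[b cb eb]].
    have [|b /bd_eqP/(_ u)] := ex1.
      by move=> w; rewrite sg; case: eqP; rewrite ?bdry0.
    rewrite sg eqxx => eb; exists (strand u b) => //; exact: carried_strand.
  rewrite -[g]/(if true then g else 0) -(eqxx u) -sg; apply: ex2.
  exists (homogenize u b); apply/bd_eqP => w; rewrite sg strand_homogenize //.
  by case: eqP; rewrite ?bdry0.
split=> [c0|[b /bd_eqP eb] u].
  apply: strands_assemble => u; apply/(ac u) => //; exact: carried_strand.
apply/(ac u); first exact: carried_strand.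
by exists (strand u b); [exact: carried_strand|rewrite eb].
Qed.

End Strands.

(** * The criterion for supporting a resolution *)

Lemma label_set1 n (V : finType) (m : V -> 'X_{1..n}) v : label m [set v] = m v.
Proof. by apply/mnmP => i; rewrite labelE big_set1. Qed.

Section Criterion.
Variables (k : fieldType) (n : nat) (V : finType) (m : V -> 'X_{1..n}).
Local Notation S := {mpoly k[n]}.
Variables (D : {set {set V}}) (I : S -> Prop).
Hypothesis D_closed : forall s t : {set V}, s \in D -> t \subset s -> t \in D.

Let rk : V -> nat := fun v => enum_rank v.

Lemma acyclic_of_resolution :
  supports_free_resolution m D I -> forall u, acyclic k rk (below m D u).
Proof.
case=> _ ex0 ex1; apply/graded_exactP => // -[|i] c.
  by rewrite -augmentation_eq0.
by rewrite -bd_eq0.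
Qed.

Lemma resolution_of_acyclic :
    (forall p, I p <-> ideal_gen (fun x => exists v, x = 'X_[m v]) p) ->
    (forall v, [set v] \in D) ->
    (forall u, acyclic k rk (below m D u)) ->
  supports_free_resolution m D I.
Proof.
move=> genI vD /(graded_exactP k m D_closed) ex; split=> [p|c|i c].
- rewrite genI; split=> [|[c <-]]; last first.
    apply: (big_ind (ideal_gen _)) => [||x _]; first exact: ideal_gen0.
      by move=> x y; exact: ideal_genD.
    apply/ideal_genM/ideal_gen_mem; have /andP[_ /cards1P[v ->]] := valP x.
    by exists v; rewrite label_set1.
  apply: (@ideal_gen_min _ _ (fun x => exists c : chain k n D 0,
    augmentation m c = x)) => [|_ _ [c <-] [d <-]|a _ [v ->]].
  + by exists 0; rewrite /augmentation big1 // => x _; rewrite ffunE mul0r.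
  + exists (c + d); rewrite /augmentation -big_split; apply: eq_bigr => x _.
    by rewrite ffunE mulrDl.
  have vP : ([set v] \in D) && (#|[set v]| == 1%N) by rewrite vD cards1.
  exists [ffun x => if val x == [set v] then a else 0].
  rewrite /augmentation (bigD1 (exist _ [set v] vP)) //= ffunE eqxx.
  rewrite label_set1 big1 ?addr0 // => x; rewrite -val_eqE /= => xv.
  by rewrite ffunE (negPf xv) mul0r.
- by rewrite augmentation_eq0 //; exact: ex.
- by rewrite bd_eq0 //; exact: ex.
Qed.

End Criterion.

(** * Scarf complexes of two families of monomials *)

Lemma scarfP (X : finType) l (e : X -> 'X_{1..l}) (s : {set X}) :
  reflect (forall t, label e t = label e s -> t = s) (s \in scarf e).
Proof.
rewrite inE; apply: (iffP forallP) => h t.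
  by move=> et; apply/eqP; have := h t; rewrite et eqxx; case: eqP.
by apply/implyP; apply: contraNN => /eqP/h ->.
Qed.

Section ScarfTransfer.
Variables (n n' : nat) (V W : finType).
Variables (m : V -> 'X_{1..n}) (m' : W -> 'X_{1..n'}) (f : W -> V).
Hypothesis f_inj : injective f.
(* Each bound on the family [m'] is cut out of the family [m] by one bound, which
   excludes everything outside the image of [f]. *)
Hypothesis lift_degree : forall u', exists u,
  [/\ forall w, (m (f w) <= u)%MM = (m' w <= u')%MM
    & forall v, (m v <= u)%MM -> v \in f @: [set: W]].
Hypothesis label_compat : forall s t : {set W},
  label m' s = label m' t -> label m (f @: s) = label m (f @: t).

Lemma label_imset_le u u' : (forall w, (m (f w) <= u)%MM = (m' w <= u')%MM) ->
  forall s : {set W}, (label m (f @: s) <= u)%MM = (label m' s <= u')%MM.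
Proof.
move=> fu s; rewrite !label_le; apply/forall_inP/forall_inP => h w ws.
  by rewrite -fu h // imset_f.
by case/imsetP: ws => x xs ->; rewrite fu h.
Qed.

Lemma label_le_codom u (s : {set V}) :
    (forall v, (m v <= u)%MM -> v \in f @: [set: W]) ->
  (label m s <= u)%MM -> s \subset f @: [set: W].
Proof.
by move=> uf; rewrite label_le => /forall_inP h; apply/subsetP => v /h /uf.
Qed.

(** A set with the label of [f @: s] satisfies every bound that [f @: s] does, so
by [lift_degree] it lies in the image of [f], and its preimage has the label
of [s]. *)
Lemma scarf_imset (s : {set W}) : (s \in scarf m') = (f @: s \in scarf m).
Proof.
apply/idP/idP => /scarfP h; apply/scarfP => t et; last first.
  by apply: (imset_inj f_inj); apply/h/label_compat.
have [u [fu uf]] := lift_degree (label m' s).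
have su : (label m (f @: s) <= u)%MM.
  by rewrite (label_imset_le fu) lepm_refl.
have tf : t \subset f @: [set: W] by apply: label_le_codom uf _; rewrite et.
have ft : f @: (f @^-1: t) = t by exact: imset_preimset.
rewrite -ft (h (f @^-1: t)) //; clear h.
have le_eq u1 : (label m' (f @^-1: t) <= u1)%MM = (label m' s <= u1)%MM.
  have [u2 [fu2 _]] := lift_degree u1.
  by rewrite -!(label_imset_le fu2) ft et.
apply/mnmP => i; apply/eqP; rewrite eqn_leq.
apply/andP; split; move: i; apply/mnm_lepP.
  by rewrite le_eq lepm_refl.
by rewrite -le_eq lepm_refl.
Qed.

Lemma scarf_acyclic_transfer (k : fieldType) :
    (forall u, acyclic k (fun v : V => enum_rank v) (below m (scarf m) u)) ->
  forall u', acyclic k (fun w : W => enum_rank w) (below m' (scarf m') u').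
Proof.
move=> ac u'; have [u [fu uf]] := lift_degree u'.
apply: (acyclic_transfer f_inj _ _ _ _ (ac u)).
- by move=> s; rewrite in_below => /andP[_]; exact: label_le_codom.
- by move=> s; rewrite !in_below scarf_imset (label_imset_le fu).
- by move=> x y /val_inj/enum_rank_inj.
- by move=> x y /val_inj/enum_rank_inj.
Qed.

End ScarfTransfer.

(** * Powers of extremal ideals *)

Section Weights.
Local Open Scope nat_scope.

Definition wsum q r (a : weight q r) (A : {set 'I_q}) : nat :=
  \sum_(i in A) val a i.

Definition nonempty_of q (A : {set 'I_q}) (A0 : A != set0) : nonempty_subset q :=
  exist _ A A0.

Lemma weight_of_subproof q r (h : 'I_q -> nat) : \sum_i h i = r ->
  \sum_i ([ffun i => inord (h i)] : {ffun 'I_q -> 'I_r.+1}) i == r.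
Proof.
move=> hr; apply/eqP; rewrite -[RHS]hr; apply: eq_bigr => i _.
by rewrite ffunE inordK // ltnS -hr (bigD1 i) //= leq_addr.
Qed.

Definition weight_of q r (h : 'I_q -> nat) (hr : \sum_i h i = r) : weight q r :=
  exist _ [ffun i => inord (h i)] (weight_of_subproof hr).

Lemma weight_ofE q r h (hr : \sum_i h i = r) (i : 'I_q) :
  val (weight_of hr) i = h i :> nat.
Proof. by rewrite ffunE inordK // ltnS -hr (bigD1 i) //= leq_addr. Qed.

Lemma weight_ext q r (a b : weight q r) :
  (forall i, val a i = val b i :> nat) -> a = b.
Proof. by move=> e; apply/val_inj/ffunP => i; apply/val_inj/e. Qed.

Lemma wsum_le q r (a : weight q r) A : wsum a A <= r.
Proof.
by rewrite -[leqRHS](eqP (valP a)) /wsum big_mkcond leq_sum // => i _; case: ifP.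
Qed.

Lemma wsumT q r (a : weight q r) : wsum a setT = r.
Proof.
by rewrite -[RHS](eqP (valP a)); apply: eq_bigl => i; rewrite inE.
Qed.

Lemma extremal_mnm_leP q (x y : 'X_{1..nvars q}) :
  reflect (forall A : nonempty_subset q, x (enum_rank A) <= y (enum_rank A))
    (x <= y)%MM.
Proof.
apply: (iffP mnm_lepP) => [le A|le i]; first exact: le.
by rewrite -(enum_valK i).
Qed.

Lemma extremal_pow_wsum q r (a : weight q r) (A : nonempty_subset q) :
  extremal_pow_gen a (enum_rank A) = wsum a (val A).
Proof. exact: extremal_pow_genE. Qed.

Lemma label_extremal q r (s : {set weight q r}) (A : nonempty_subset q) :
  label (@extremal_pow_gen q r) s (enum_rank A) = \max_(a in s) wsum a (val A).
Proof. by rewrite labelE; apply: eq_bigr => a _; rewrite extremal_pow_wsum. Qed.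

(** No generator divides another, so a set of generators with the label of [a] is
contained in [[set a]]; it is not empty, because the generators are not 1. *)
Lemma vertex_scarf q r (a : weight q r) : 0 < q -> 0 < r ->
  [set a] \in extremal_scarf q r.
Proof.
move=> q0 r0; apply/scarfP => t; rewrite label_set1 => et.
have ta : t \subset [set a].
  apply/subsetP => b bt; rewrite inE; apply/eqP.
  (* Minimality is a statement on exponents: any field gives it. *)
  have [min _] := extremal_pow_gen_min rat q r; apply: min.
  have := lepm_refl (extremal_pow_gen a); rewrite -{1}et label_le.
  by move/forall_inP; apply.
move: ta; rewrite subset1 => /orP[/eqP //|/eqP t0].
have T0 : [set: 'I_q] != set0.
  by apply/set0Pn; exists (Ordinal q0); rewrite inE.
move/mnmP/(_ (enum_rank (nonempty_of T0))): et.
rewrite label_extremal t0 big_set0 extremal_pow_wsum wsumT => e.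
by rewrite -e in r0.
Qed.

Lemma scarf_resolves_transfer (k : fieldType) q r q' r'
    (f : weight q' r' -> weight q r) :
    0 < q' -> 0 < r' -> injective f ->
    (forall u', exists u,
      [/\ forall w, (extremal_pow_gen (f w) <= u)%MM =
            (extremal_pow_gen w <= u')%MM
        & forall v, (extremal_pow_gen v <= u)%MM -> v \in f @: [set: _]]) ->
    (forall s t : {set weight q' r'},
      label (@extremal_pow_gen q' r') s = label (@extremal_pow_gen q' r') t ->
      label (@extremal_pow_gen q r) (f @: s) =
      label (@extremal_pow_gen q r) (f @: t)) ->
  scarf_resolves k q r -> scarf_resolves k q' r'.
Proof.
move=> q0 r0 f_inj fu fl res; apply: resolution_of_acyclic.
- by move=> s t; exact: scarf_closed.
- by have [] := extremal_pow_gen_min k q' r'.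
- by move=> a; exact: vertex_scarf.
apply: (scarf_acyclic_transfer f_inj fu fl); apply: acyclic_of_resolution res.
by move=> s t; exact: scarf_closed.
Qed.

(** * Extending weight vectors by a zero entry *)

Section Extend.
Variables q r : nat.

Let ext0 (a : weight q r) (i : 'I_q.+1) : nat :=
  if unlift ord0 i is Some j then val a j else 0.

Lemma sum_ext0 a : \sum_i ext0 a i = r.
Proof.
rewrite big_ord_recl /ext0 unlift_none add0n -[RHS](eqP (valP a)).
by apply: eq_bigr => j _; rewrite liftK.
Qed.

Definition extend a : weight q.+1 r := weight_of (sum_ext0 a).

Lemma extend_lift a j : val (extend a) (lift ord0 j) = val a j :> nat.
Proof. by rewrite weight_ofE /ext0 liftK. Qed.

Lemma extend_ord0 a : val (extend a) ord0 = 0 :> nat.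
Proof. by rewrite weight_ofE /ext0 unlift_none. Qed.

Lemma extend_inj : injective extend.
Proof. by move=> a b e; apply: weight_ext => j; rewrite -!extend_lift e. Qed.

Definition trace (A : {set 'I_q.+1}) : {set 'I_q} := lift ord0 @^-1: A.

Lemma wsum_extend a A : wsum (extend a) A = wsum a (trace A).
Proof.
rewrite /wsum big_mkcond big_ord_recl extend_ord0 if_same /= add0n.
by rewrite [RHS]big_mkcond; apply: eq_bigr => j _; rewrite inE extend_lift.
Qed.

Lemma trace_imset (B : {set 'I_q}) : trace (lift ord0 @: B) = B.
Proof. by apply/setP => j; rewrite inE mem_imset //; exact: lift_inj. Qed.

Lemma imset_lift_neq0 (B : nonempty_subset q) :
  lift ord0 @: val B != set0 :> {set 'I_q.+1}.
Proof. by rewrite imset_eq0; exact: valP B. Qed.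

Lemma extend_codom (b : weight q.+1 r) :
  val b ord0 = 0 :> nat -> b \in extend @: [set: weight q r].
Proof.
move=> b0; have sb : \sum_j (val b (lift ord0 j) : nat) = r.
  by rewrite -[RHS](eqP (valP b)) big_ord_recl b0.
apply/imsetP; exists (weight_of sb) => //; apply: weight_ext => i.
by case: (unliftP ord0 i) => [j|] ->;
  rewrite ?extend_lift ?extend_ord0 ?weight_ofE.
Qed.

(** The exponent of an extended generator at [A] is that of the original one at
[trace A], so the bound at [A] is copied from there.  Where the trace is empty,
that is at [A = {0}], the bound 0 forces the entry at 0 to vanish. *)
Lemma extend_lift_degree (u' : 'X_{1..nvars q}) : exists u,
  [/\ forall a, (extremal_pow_gen (extend a) <= u)%MM =
        (extremal_pow_gen a <= u')%MM
    & forall b, (extremal_pow_gen b <= u)%MM ->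
        b \in extend @: [set: weight q r]].
Proof.
exists [multinom if insub (trace (val (enum_val i))) is Some B
  then u' (enum_rank (B : nonempty_subset q)) else 0 | i < nvars q.+1].
split=> [a|b /extremal_mnm_leP le].
  apply/extremal_mnm_leP/extremal_mnm_leP => le.
    move=> B; have := le (nonempty_of (imset_lift_neq0 B)).
    rewrite mnmE !extremal_pow_wsum enum_rankK /= wsum_extend.
    by rewrite trace_imset valK.
  move=> A; rewrite mnmE extremal_pow_wsum enum_rankK wsum_extend.
  case: insubP => [B _ <-|].
    by have := le B; rewrite extremal_pow_wsum.
  by rewrite negbK => /eqP ->; rewrite /wsum big_set0.
apply: extend_codom; apply/eqP; rewrite -leqn0.
have A0 : [set ord0] != set0 :> {set 'I_q.+1}.
  by apply/set0Pn; exists ord0; rewrite inE.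
have := le (nonempty_of A0); rewrite mnmE extremal_pow_wsum enum_rankK /wsum big_set1.
case: insubP => // B + eB; case/set0Pn => j.
by rewrite /trace !inE => /eqP e; have := neq_lift ord0 j; rewrite e eqxx.
Qed.

Lemma extend_label (s t : {set weight q r}) :
    label (@extremal_pow_gen q r) s = label (@extremal_pow_gen q r) t ->
  label (@extremal_pow_gen q.+1 r) (extend @: s) =
  label (@extremal_pow_gen q.+1 r) (extend @: t).
Proof.
move=> e; apply/mnmP => i; rewrite -(enum_valK i); set A := enum_val i.
rewrite !label_extremal !big_imset /=; try by move=> ? ? _ _; exact: extend_inj.
under eq_bigr do rewrite wsum_extend.
under [RHS]eq_bigr do rewrite wsum_extend.
have [A0|A0] := eqVneq (trace (val A)) set0.
  by rewrite !big1 // => a _; rewrite A0 /wsum big_set0.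
have /mnmP/(_ (enum_rank (nonempty_of A0))) := e.
by rewrite !label_extremal.
Qed.

End Extend.

(** * Shifting weight vectors by a unit vector *)

Section Shift.
Variables q r : nat.

Lemma sum_shift (a : weight q.+1 r) :
  \sum_i (val a i + (i == ord0)) = r.+1.
Proof.
rewrite big_split /= (eqP (valP a)) (bigD1 ord0) //= big1 ?addn1 //.
by move=> i /negPf ->.
Qed.

Definition shift a : weight q.+1 r.+1 := weight_of (sum_shift a).

Lemma shiftE a i : val (shift a) i = val a i + (i == ord0) :> nat.
Proof. by rewrite weight_ofE. Qed.

Lemma shift_inj : injective shift.
Proof.
move=> a b e; apply: weight_ext => i.
by apply: (@addIn (i == ord0)); rewrite -!shiftE e.
Qed.

Lemma wsum_shift a A : wsum (shift a) A = wsum a A + (ord0 \in A).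
Proof.
rewrite /wsum; under eq_bigr do rewrite shiftE.
rewrite big_split /=; congr (_ + _); case: (boolP (ord0 \in A)) => A0.
  by rewrite (bigD1 ord0) //= big1 // => i /andP[_ /negPf ->].
by rewrite big1 // => i iA; case: eqP iA => // ->; rewrite (negPf A0).
Qed.

Lemma shift_codom (b : weight q.+1 r.+1) :
  0 < val b ord0 -> b \in shift @: [set: weight q.+1 r].
Proof.
move=> b0; have h i : val b i = val b i - (i == ord0) + (i == ord0) :> nat.
  by rewrite subnK //; case: eqP => // ->.
have sb : \sum_i (val b i - (i == ord0)) = r.
  apply: (@addIn 1); rewrite [RHS]addn1 -[RHS](eqP (valP b)).
  rewrite [RHS](eq_bigr _ (fun i _ => h i)).
  rewrite big_split /=; congr (_ + _).
  by rewrite (bigD1 ord0) //= big1 // => i /negPf ->.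
apply/imsetP; exists (weight_of sb) => //; apply: weight_ext => i.
by rewrite shiftE weight_ofE.
Qed.

(** Every exponent of a generator of the [r]-th power is at most [r], so cutting
the given bound at [r] is harmless.  After this cut, the bound at the complement
of [{0}] leaves at least 1 for the entry at 0; when the complement is empty, the
entry at 0 is the whole sum [r + 1]. *)
Lemma shift_lift_degree (u' : 'X_{1..nvars q.+1}) : exists u,
  [/\ forall a, (extremal_pow_gen (shift a) <= u)%MM =
        (extremal_pow_gen a <= u')%MM
    & forall b, (extremal_pow_gen b <= u)%MM ->
        b \in shift @: [set: weight q.+1 r]].
Proof.
exists [multinom minn (u' i) r + (ord0 \in val (enum_val i)) | i < nvars q.+1].
split=> [a|b /extremal_mnm_leP le].
  apply/extremal_mnm_leP/extremal_mnm_leP => le A; have := le A;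
    rewrite mnmE !extremal_pow_wsum enum_rankK wsum_shift;
    by rewrite leq_add2r leq_min wsum_le andbT.
apply: shift_codom.
have sb : val b ord0 + wsum b (~: [set ord0]) = r.+1.
  rewrite -[RHS](eqP (valP b)) [RHS](bigD1 ord0) //=; congr (_ + _).
  by apply: eq_bigl => i; rewrite !inE.
suff : wsum b (~: [set ord0]) <= r.
  by case: (posnP (val b ord0)) sb => // ->; rewrite add0n => ->; rewrite ltnn.
have [->|A0] := eqVneq (~: [set ord0 : 'I_q.+1]) set0.
  by rewrite /wsum big_set0.
have := le (nonempty_of A0); rewrite mnmE extremal_pow_wsum enum_rankK /=.
by rewrite !inE eqxx addn0 => /leq_trans; apply; exact: geq_minr.
Qed.

(** The shift adds the same constant to all exponents at a given variable, which
commutes with maxima over nonempty sets.  For [r > 0] the label tells whether a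
set is empty, since the exponent at the full index set is [r] or 0. *)
Lemma shift_label (s t : {set weight q.+1 r}) : 0 < r ->
    label (@extremal_pow_gen q.+1 r) s = label (@extremal_pow_gen q.+1 r) t ->
  label (@extremal_pow_gen q.+1 r.+1) (shift @: s) =
  label (@extremal_pow_gen q.+1 r.+1) (shift @: t).
Proof.
move=> r0 e.
have T0 : [set: 'I_q.+1] != set0 by apply/set0Pn; exists ord0; rewrite inE.
have posE (x : {set weight q.+1 r}) : (x != set0) =
    (0 < label (@extremal_pow_gen q.+1 r) x
       (enum_rank (nonempty_of T0))).
  rewrite label_extremal; have [->|/set0Pn[a ax]] := eqVneq x set0.
    by rewrite big_set0.
  apply/esym; apply: leq_trans r0 _.
  by apply: (bigmax_sup a) => //; rewrite wsumT.
have est : (s != set0) = (t != set0) by rewrite !posE e.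
have [s0|s0] := eqVneq s set0.
  by move: est; rewrite s0 eqxx => /esym/negbFE/eqP ->.
have maxE (x : {set weight q.+1 r}) (A : nonempty_subset q.+1) : x != set0 ->
    \max_(b in shift @: x) wsum b (val A) =
    \max_(a in x) wsum a (val A) + (ord0 \in val A).
  move=> x0; rewrite big_imset; last by move=> ? ? _ _; exact: shift_inj.
  apply/eqP; rewrite eqn_leq; apply/andP; split.
    apply/bigmax_leqP => a ax; rewrite /= wsum_shift leq_add2r.
    exact: leq_bigmax_cond.
  have [|a ax ->] := @eq_bigmax_cond _ (mem x) (fun a => wsum a (val A)).
    by rewrite card_gt0.
  by rewrite -wsum_shift; apply: (bigmax_sup a).
apply/mnmP => i; rewrite -(enum_valK i) !label_extremal !maxE -?est //.
by congr (_ + _); rewrite -!label_extremal e.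
Qed.

End Shift.
End Weights.

Theorem theorem1p3 (k : fieldType) (q r : nat) :
  (0 < q)%N -> (0 < r)%N ->
  scarf_resolves k q r ->
  ((2 <= q)%N -> scarf_resolves k q.-1 r) /\
  ((2 <= r)%N -> scarf_resolves k q r.-1).
Proof.
move=> q0 r0 res; split.
  case: q q0 res => // q _ res q1.
  apply: (scarf_resolves_transfer q1 r0 (@extend_inj q r)) res.
    exact: extend_lift_degree.
  exact: extend_label.
case: q q0 res => // q _ res; case: r r0 res => // r _ res r1.
apply: (scarf_resolves_transfer _ r1 (@shift_inj q r)) res => //.
  exact: shift_lift_degree.
by move=> s t; exact: shift_label.
Qed.
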